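(* Let $a<b$ be real numbers, let $u:[a,b]\to[0,\infty)$ be monotonic increasing on $[a,b]$, and let $f:[a,b]\to\mathbb{R}$ be of bounded variation on $[a,b]$. Then $$\left|\frac13\left\{\left[u\left(\tfrac{a+b}{2}\right)-u(a)\right]f(a)+2[u(b)-u(a)]f\left(\tfrac{a+b}{2}\right)+\left[u(b)-u\left(\tfrac{a+b}{2}\right)\right]f(b)\right\}-\int_a^b f(t)\,du(t)\right|$$ $$\le\frac23\left[\frac{u(b)-u(a)}{2}+\left|u\left(\tfrac{a+b}{2}\right)-\frac{u(a)+u(b)}{2}\right|\right]\cdot\bigvee_a^b(f).$$ The constant $\frac23$ is the best possible, i.e. it cannot be replaced by a smaller constant for which the inequality still holds for all such $u,f$.
   Context: $\bigvee_a^b(f)$ denotes the total variation of $f$ over $[a,b]$. Integrals with respect to $du$ are Riemann–Stieltjes integrals.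
   Formalization: The existence of the Riemann–Stieltjes integral of f with respect to u over [a,b] is assumed, since it can fail when f and u jump at the same point (e.g. both the indicator of t ≥ (a+b)/2); sharpness is shown within this class for each a<b. *)

(* Defs.v *)
From HB Require Import structures.
From mathcomp Require Import all_boot all_order all_algebra.
From mathcomp Require Import classical_sets reals constructive_ereal.
From mathcomp Require Import numfun realfun.

Set Implicit Arguments.
Unset Strict Implicit.
Unset Printing Implicit Defensive.

Import Order.TTheory GRing.Theory Num.Theory.
Local Open Scope ring_scope.

(* As in [itv_partition a b s], the subdivision points are those of [a :: s]:
   [s] omits the left end a and ends with b. *)
Definition subdiv_pt (R : realType) (a b : R) (s : seq R) (i : nat) : R :=
  nth b (a :: s) i.

Definition RS_sum (R : realType) (f u : R -> R) (a b : R)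
    (s : seq R) (xi : nat -> R) : R :=
  \sum_(0 <= i < size s)
    f (xi i) * (u (subdiv_pt a b s i.+1) - u (subdiv_pt a b s i)).

(* The Riemann-Stieltjes integral of f with respect to u over [a, b] exists and
   equals I, as the limit of the sums when the mesh of the tagged subdivision
   tends to 0. *)
Definition is_RS_integral (R : realType) (f u : R -> R) (a b I : R) : Prop :=
  forall eps : R, 0 < eps -> exists2 delta : R, 0 < delta &
    forall (s : seq R) (xi : nat -> R),
      itv_partition a b s ->
      (forall i, (i < size s)%N ->
         subdiv_pt a b s i.+1 - subdiv_pt a b s i < delta) ->
      (forall i, (i < size s)%N ->
         subdiv_pt a b s i <= xi i <= subdiv_pt a b s i.+1) ->
      `|RS_sum f u a b s xi - I| < eps.

(* For functions on [a, b], represented by total functions of which only the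
   values on [a, b] matter. Monotonicity of u and bounded variation of f do not
   make the integral exist (both may jump at the same point), so its existence
   with value I is a hypothesis. *)
Definition simpson_RS_bound (R : realType) (a b C : R) : Prop :=
  forall (u f : R -> R) (I : R),
    {in `[a, b], forall x, 0 <= u x} ->
    {in `[a, b] &, {homo u : x y / x <= y}} ->
    bounded_variation a b f ->
    is_RS_integral f u a b I ->
    let m := (a + b) / 2 in
    `|1 / 3 * ((u m - u a) * f a + 2 * (u b - u a) * f m + (u b - u m) * f b)
      - I|
    <= C * ((u b - u a) / 2 + `|u m - (u a + u b) / 2|)
       * fine (total_variation a b f).

(* Main.v *)
Require Import Defs.
From mathcomp Require Import all_boot all_order all_algebra.
From mathcomp Require Import reals.
From mathcomp Require Import constructive_ereal numfun realfun ring lra.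

Import Order.TTheory GRing.Theory Num.Theory.
Local Open Scope ring_scope.

(** With [m] the midpoint, the error on [[a, m]] is the integral of
    [f a / 3 + 2 f m / 3 - f] against [du], and the integrand is at most
    [2/3] of the variation of [f] on [[a, m]]; symmetrically on [[m, b]].
    Adding up, the larger of the two increments of [u] factors out: it is
    [(u b - u a) / 2 + |u m - (u a + u b) / 2|].  It suffices to check this on
    Riemann-Stieltjes sums over the subdivisions into [2n] equal parts, which
    contain [m]; no integral over a half interval is needed.
    The constant is attained by [u] jumping right after [a] and [f] jumping
    at [m]. *)

Lemma subdiv_pt_mkseq (R : realType) (p : nat -> R) (N i : nat) :
  (i <= N)%N -> subdiv_pt (p 0%N) (p N) (mkseq (p \o S) N) i = p i.
Proof.
by case: i => [|i] // iN; rewrite /subdiv_pt /= nth_mkseq.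
Qed.

Lemma itv_partition_mkseq (R : realType) (p : nat -> R) (N : nat) :
  (forall i, p i < p i.+1) -> itv_partition (p 0%N) (p N) (mkseq (p \o S) N).
Proof.
move=> pS; split.
  apply/(pathP (p N)) => i; rewrite size_mkseq => iN.
  rewrite -[nth _ (_ :: _) _]/(subdiv_pt _ _ _ _) subdiv_pt_mkseq 1?ltnW//.
  by rewrite nth_mkseq.
by case: N => [|N] //; rewrite (last_nth 0) size_mkseq /= nth_mkseq.
Qed.

(** Since [al + be = 1], the quantity splits into [al * (f x - f t)] and [be * (f y - f t)], whose
    differences are controlled by the variations on the two sides of [t]; these add up to the
    variation on the whole interval. *)
Lemma endpoint_mean_deviation (R : realType) (f : R -> R) (x y t al be K : R) :
  x <= t -> t <= y -> bounded_variation x y f ->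
  0 <= al <= K -> 0 <= be <= K -> al + be = 1 ->
  `|al * f x + be * f y - f t| <= K * fine (total_variation x y f).
Proof.
move=> xt ty bv /andP[al0 alK] /andP[be0 beK] albe.
have xy := le_trans xt ty.
have bvl := bounded_variationl xt ty bv.
have bvr := bounded_variationr xt ty bv.
have fl := (bounded_variationP f xt).1 bvl.
have fr := (bounded_variationP f ty).1 bvr.
have gl := total_variation_ge f xt.
have gr := total_variation_ge f ty.
rewrite (total_variationD f xt ty) fineD//.
rewrite -(fineK fl) lee_fin in gl; rewrite -(fineK fr) lee_fin in gr.
have -> : al * f x + be * f y - f t = al * (f x - f t) + be * (f y - f t).
  by rewrite -[f t in LHS]mul1r -albe; ring.
apply: le_trans (ler_normD _ _) _.
rewrite !normrM (ger0_norm al0) (ger0_norm be0) mulrDr lerD//.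
  by rewrite distrC ler_pM.
by rewrite ler_pM.
Qed.

(** Telescoping [u (p k) - u (p j)] turns the difference into a sum of [c - f (xi i)] weighted by
    the nonnegative increments of [u]. *)
Lemma RS_sum_deviation (R : realType) (f u : R -> R) (p xi : nat -> R)
    (c K : R) (j k : nat) :
  (j <= k)%N ->
  (forall i, (j <= i < k)%N -> u (p i) <= u (p i.+1)) ->
  (forall i, (j <= i < k)%N -> `|c - f (xi i)| <= K) ->
  `|(u (p k) - u (p j)) * c
    - \sum_(j <= i < k) f (xi i) * (u (p i.+1) - u (p i))|
  <= K * (u (p k) - u (p j)).
Proof.
move=> jk uS cK.
rewrite -(telescope_sumr (u \o p) jk) mulr_suml mulr_sumr -sumrB.
apply: le_trans (ler_norm_sum _ _ _) _.
rewrite big_nat [leRHS]big_nat; apply: ler_sum => i ijk /=.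
rewrite [X in X - _]mulrC -mulrBl normrM ler_pM// ?cK//.
by rewrite ger0_norm// subr_ge0 uS.
Qed.

Lemma simpson_RS_bound_two_thirds (R : realType) (a b : R) :
  a < b -> simpson_RS_bound a b (2 / 3).
Proof.
move=> ab u f I _ ndu bv HI; lazy zeta; set m := (a + b) / 2.
have am : a < m by rewrite /m; lra.
have mb : m < b by rewrite /m; lra.
have itv x : a <= x -> x <= b -> x \in `[a, b].
  by move=> ax xb; rewrite in_itv /= ax.
have bvl := bounded_variationl (ltW am) (ltW mb) bv.
have bvr := bounded_variationr (ltW am) (ltW mb) bv.
apply/ler_addgt0Pl => eps eps0.
have [delta d0 Hd] := HI eps eps0.
(* Archimedes makes the step [h] smaller than [delta]; the even number [2 * n] of parts puts [m] at
   index [n], and the successor keeps [n] nonzero. *)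
pose n := (Num.bound ((b - a) / delta)).+1.
pose h := (b - a) / (2 * n)%:R.
have n0 : (0 : R) < (2 * n)%:R by rewrite ltr0n.
have h0 : 0 < h by rewrite divr_gt0// subr_gt0.
pose p i : R := a + h * i%:R.
have pS i : p i < p i.+1 by rewrite /p -addn1 natrD; lra.
have ple i j : (i <= j)%N -> p i <= p j.
  by move=> ij; rewrite /p lerD2l ler_pM2l// ler_nat.
have p0 : p 0%N = a by rewrite /p mulr0 addr0.
have pn : p n = m.
  by rewrite /p /h /m natrM; field; rewrite pnatr_eq0.
have p2n : p (2 * n)%N = b by rewrite /p /h divfK ?gt_eqF//; ring.
have hd : h < delta.
  rewrite /h ltr_pdivrMr// mulrC -ltr_pdivrMr//.
  apply: lt_trans (archi_boundP _) _; first by rewrite divr_ge0 ?subr_ge0 ?ltW.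
  by rewrite ltr_nat leq_pmull.
have n2n : (n <= 2 * n)%N by rewrite leq_pmull.
have sub i : (i <= 2 * n)%N -> subdiv_pt a b (mkseq (p \o S) (2 * n)) i = p i.
  by rewrite -{1}p0 -{1}p2n; exact: subdiv_pt_mkseq.
(* Each tag is the left end of its subinterval, so [p] itself is the tag function. *)
have := Hd (mkseq (p \o S) (2 * n)) p.
rewrite size_mkseq => /(_ _)/wrap[].
  by rewrite -{1}p0 -{1}p2n; exact: itv_partition_mkseq.
move=> /(_ _)/wrap[] => [i i2n|].
  rewrite !sub ?(ltnW i2n)//; apply: le_lt_trans hd.
  by rewrite /p -[in X in X - _]addn1 natrD; lra.
move=> /(_ _)/wrap[] => [i i2n|].
  by rewrite !sub ?(ltnW i2n)// lexx ltW.
rewrite /RS_sum size_mkseq big_nat.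
under eq_bigr => i i2n do rewrite !sub ?(ltnW (andP i2n).2) ?(andP i2n).2//.
rewrite -big_nat (big_cat_nat _ n2n)//=.
set S1 := \sum_(0 <= i < n) _; set S2 := \sum_(n <= i < 2 * n) _ => SI.
have inab i : (i <= 2 * n)%N -> p i \in `[a, b].
  by move=> i2n; rewrite itv// -?p0 -?p2n ple.
have uS i : (i < 2 * n)%N -> u (p i) <= u (p i.+1).
  by move=> i2n; apply: ndu; rewrite ?inab ?ltW// ltnW.
(* For [i < n] the tags lie in [[a, m]]; the weights [1 / 3] and [2 / 3] are both at most
   [2 / 3]. *)
have E1 : `|(u m - u a) * (1 / 3 * f a + 2 / 3 * f m) - S1|
    <= 2 / 3 * fine (total_variation a m f) * (u m - u a).
  rewrite -pn -{1 4}p0; apply: RS_sum_deviation => // i /andP[_ ik].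
    by rewrite uS// (leq_trans ik).
  apply: endpoint_mean_deviation; rewrite ?pn//; try lra.
    by rewrite -p0 ple.
  by rewrite -pn ple// ltnW.
have E2 : `|(u b - u m) * (2 / 3 * f m + 1 / 3 * f b) - S2|
    <= 2 / 3 * fine (total_variation m b f) * (u b - u m).
  rewrite -pn -{1 4}p2n; apply: RS_sum_deviation => // i /andP[nk ik].
    by rewrite uS.
  apply: endpoint_mean_deviation; rewrite ?pn//; try lra.
    by rewrite -pn ple.
  by rewrite -p2n ple// ltnW.
have tvl := total_variation_ge0 f (ltW am).
have tvr := total_variation_ge0 f (ltW mb).
have fl := (bounded_variationP f (ltW am)).1 bvl.
have fr := (bounded_variationP f (ltW mb)).1 bvr.
rewrite (total_variationD f (ltW am) (ltW mb)) fineD//.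
move: E1 E2 (fine_ge0 tvl) (fine_ge0 tvr).
move: (fine (total_variation a m f)) (fine (total_variation m b f)).
move=> V1 V2 E1 E2 V10 V20.
pose M := (u b - u a) / 2 + `|u m - (u a + u b) / 2|.
have M1 : u m - u a <= M.
  by have := ler_norm (u m - (u a + u b) / 2); rewrite /M; lra.
have M2 : u b - u m <= M.
  by rewrite /M distrC;
     have := ler_norm ((u a + u b) / 2 - u m); lra.
have F1 : V1 * (u m - u a) <= V1 * M by exact: ler_wpM2l.
have F2 : V2 * (u b - u m) <= V2 * M by exact: ler_wpM2l.
rewrite -/M.
set A := (u m - u a) * _ in E1; set B := (u b - u m) * _ in E2.
have -> : 1 / 3 * ((u m - u a) * f a + 2 * (u b - u a) * f m
    + (u b - u m) * f b) = A + B by rewrite /A /B; field.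
(* The first bracket costs [eps]; the other two are bounded by [E1] and [E2]. *)
have -> : A + B - I = (S1 + S2 - I) + ((A - S1) + (B - S2)) by ring.
apply: le_trans (ler_normD _ _) _; rewrite lerD ?(ltW SI)//.
apply: le_trans (ler_normD _ _) _; apply: le_trans (lerD E1 E2) _.
by lra.
Qed.

Lemma total_variation_step (R : realType) (a b m : R) :
  a < m -> m <= b ->
  bounded_variation a b (fun t : R => (m <= t)%R%:R : R) /\
  fine (total_variation a b (fun t : R => (m <= t)%R%:R : R)) = 1.
Proof.
move=> am mb; have ab := le_trans (ltW am) mb.
have nd : {in `[a, b] &, {homo (fun t : R => (m <= t)%R%:R : R) : x y / x <= y}}.
  move=> x y _ _ xy; rewrite ler_nat; case: (leP m x) => // mx.
  by rewrite (le_trans mx xy).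
split; first exact: nondecreasing_bounded_variation.
by rewrite nondecreasing_total_variation//= mb leNgt am subr0.
Qed.

(** The integrator is 0 at [a] and 1 at all later subdivision points, so only the first term
    survives. With mesh below [m - a] its tag lies in [[a, m)], where [f] is [c]: the sum equals [c]
    exactly. *)
Lemma is_RS_integral_step (R : realType) (f : R -> R) (a b m c : R) :
  a < m -> a < b -> (forall t, a <= t < m -> f t = c) ->
  is_RS_integral f (fun t : R => (a < t)%R%:R) a b c.
Proof.
move=> am ab fc eps eps0; exists (m - a) => [|s xi]; first by rewrite subr_gt0.
case: s => [/itv_partition_nil ab0|x s part mesh tag].
  by rewrite ab0 ltxx in ab.
have gta i : (i < size (x :: s))%N -> a < subdiv_pt a b (x :: s) i.+1.
  by move=> si; have [/lt_path_min/(all_nthP b)/(_ i si)] := part.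
rewrite /RS_sum big_nat_recl//= big_nat big1 => [|i /= si].
  have /andP[a_xi xi_x] := tag 0%N isT; have x_m := mesh 0%N isT.
  rewrite addr0 gta// ltxx subr0 mulr1 fc ?subrr ?normr0// a_xi.
  by move: xi_x x_m; rewrite /subdiv_pt /=; lra.
by rewrite !gta ?subrr ?mulr0 //= ltnW.
Qed.

Theorem corollary3 (R : realType) (a b : R) (hab : a < b) :
  simpson_RS_bound a b (2 / 3) /\
  (forall C : R, C < 2 / 3 -> ~ simpson_RS_bound a b C).
Proof.
split=> [|C C23 bound]; first exact: simpson_RS_bound_two_thirds.
pose m := (a + b) / 2.
have am : a < m by rewrite /m; lra.
have mb : m < b by rewrite /m; lra.
have [bv tv] := total_variation_step _ _ _ _ am (ltW mb).
have int0 : is_RS_integral (fun t : R => (m <= t)%R%:R) (fun t : R => (a < t)%R%:R) a b 0.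
  by apply: (is_RS_integral_step _ _ _ _ _ _ am hab) => t /andP[_]; rewrite ltNge => /negbTE->.
have u0 : {in `[a, b], forall t : R, 0 <= (a < t)%R%:R :> R}.
  by move=> t _; exact: ler0n.
have ndu : {in `[a, b] &, {homo (fun t : R => (a < t)%R%:R : R) : x y / x <= y}}.
  move=> x y _ _ xy; rewrite ler_nat; case: (ltP a x) => // ax.
  by rewrite (lt_le_trans ax xy).
(* Here [u a = 0], [u m = u b = 1], [f a = 0], [f m = 1] and the integral is 0: the left side is
   [2 / 3], the right side [C * (1 / 2 + 1 / 2) * 1], so [2 / 3 <= C]. *)
have := bound _ _ _ u0 ndu bv int0.
lazy zeta; rewrite -/m tv ltxx am hab lexx (lt_geF am) (ltW mb) /=.
rewrite subr0 ger0_norm ?ger0_norm; lra.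
Qed.
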